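(* Let $r_1,r_2>0$ be real numbers, let $C_1$ be the circle $(x+r_1)^2+y^2=r_1^2$ and $C_2$ the circle $(x-r_2)^2+y^2=r_2^2$. Then the circle $$(r_1^2+r_1r_2+r_2^2)(x^2+y^2)+2r_1r_2(r_2-r_1)x-4r_1r_2(r_1+r_2)y+4r_1^2r_2^2=0$$ touches $C_1$, $C_2$ and the circle with center $(r_2-r_1,0)$ and radius $r_1+r_2$. Moreover, for $r_3=-(r_1+r_2)$, the Descartes identity $$\frac1{r_4}=\frac1{r_1}+\frac1{r_2}+\frac1{r_3}\pm2\sqrt{\frac1{r_1r_2}+\frac1{r_2r_3}+\frac1{r_3r_1}}$$ gives $$r_4=\frac{r_1r_2(r_1+r_2)}{r_1^2+r_1r_2+r_2^2},$$ which is the radius of the first-mentioned circle.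
   Context: Two circles touch if they are tangent to each other (externally or internally). The negative sign of $r_3$ expresses that $C_1$ and $C_2$ touch the circle with center $(r_2-r_1,0)$ and radius $r_1+r_2$ internally, from inside that circle. *)

(* Defs.v *)
From mathcomp Require Import all_boot all_order all_algebra.
From mathcomp Require Import boolp classical_sets reals.

Set Implicit Arguments.
Unset Strict Implicit.
Unset Printing Implicit Defensive.

Import Order.TTheory GRing.Theory Num.Theory.
Local Open Scope classical_set_scope.
Local Open Scope ring_scope.

Definition circle (R : realType) (c : R * R) (r : R) : set (R * R) :=
  [set p : R * R | (p.1 - c.1) ^+ 2 + (p.2 - c.2) ^+ 2 = r ^+ 2].

(* The positivity of the radius rules out points and empty loci. *)
Definition is_circle (R : realType) (S : set (R * R)) (c : R * R) (r : R) :
    Prop :=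
  0 < r /\ S = circle c r.

Definition has_radius (R : realType) (S : set (R * R)) (r : R) : Prop :=
  exists c : R * R, is_circle S c r.

(* The line through p perpendicular to the radius from c to p; it is the      *)
(* tangent at p to a nondegenerate circle with center c passing through p.    *)
Definition tangent_line (R : realType) (c p : R * R) : set (R * R) :=
  [set q : R * R | (q.1 - p.1) * (p.1 - c.1) + (q.2 - p.2) * (p.2 - c.2) = 0].

(* Two distinct circles touch if they have the same tangent line at a common  *)
(* point. The centers may lie on opposite sides of that line (external        *)
(* tangency) or on the same side (internal tangency).                         *)
Definition touch (R : realType) (A B : set (R * R)) : Prop :=
  A <> B /\
  exists (a b : R * R) (r s : R) (p : R * R),
    [/\ is_circle A a r, is_circle B b s, A p, B p &
        tangent_line a p = tangent_line b p].

Definition descartes_radicand (R : realType) (r1 r2 r3 : R) : R :=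
  1 / (r1 * r2) + 1 / (r2 * r3) + 1 / (r3 * r1).

(* The boolean m chooses the sign of the square root, minus when m = true.    *)
(* The side conditions ensure that the inverses and the square root, which    *)
(* are total functions here, have their usual meaning.                        *)
Definition descartes_identity (R : realType) (m : bool) (r1 r2 r3 r4 : R) :
    Prop :=
  [/\ [/\ r1 != 0, r2 != 0, r3 != 0 & r4 != 0],
      0 <= descartes_radicand r1 r2 r3 &
      1 / r4 = 1 / r1 + 1 / r2 + 1 / r3
               + (-1) ^+ m * (2 * Num.sqrt (descartes_radicand r1 r2 r3))].

(* Main.v *)
Require Import Defs.
From mathcomp Require Import all_boot all_order all_algebra.
From mathcomp Require Import boolp classical_sets reals.
From mathcomp Require Import ring.

Import Order.TTheory GRing.Theory Num.Theory.
Local Open Scope classical_set_scope.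
Local Open Scope ring_scope.

(** Signed radii treat both kinds of tangency at once: circles with centers
    [a], [b] and signed radii [r], [s] touch when the distance of the centers
    is the absolute value of a nonzero sum [r + s], opposite signs meaning that
    one of the circles touches the other one from inside
    ([touch_signed_radii]).  Completing the squares shows that the given
    quadric is the circle of radius [rho] whose center [c4] is below
    ([quadric_circle]).  The three tangencies then become rational identities
    for the squared distances from that center to the points [(- r1, 0)],
    [(r2, 0)] and [(r2 - r1, 0)], the signed radii being [r1], [r2] and
    [r3 = - (r1 + r2)].

    For this [r3] the three given circles have collinear centers and are
    mutually tangent, and the Descartes radicand vanishes: both signs give the same
    value of [1 / r4], namely [1 / r1 + 1 / r2 - 1 / (r1 + r2) = 1 / rho]. *)

Lemma circle_norm (R : realType) (c : R * R) (r : R) :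
  circle c `|r| = circle c r.
Proof. by rewrite /circle real_normK // num_real. Qed.

(** The point of contact divides the segment between the centers in the
    ratio [r : s] (externally when [s < 0]), so both radii ending there are
    nonzero multiples of [b - a]. *)
Lemma touch_signed_radii (R : realType) (a b : R * R) (r s : R) :
  0 < r -> s != 0 -> r + s != 0 ->
  (a.1 - b.1) ^+ 2 + (a.2 - b.2) ^+ 2 = (r + s) ^+ 2 ->
  touch (circle a r) (circle b s).
Proof.
case: a b => [a1 a2] [b1 b2] /= r_gt0 s_neq0 rs_neq0 dist_ab.
have r_neq0 : r != 0 by rewrite gt_eqF.
set k := (r + s)^-1.
have k_neq0 : k != 0 by rewrite invr_eq0.
have unit_ab : k ^+ 2 * ((a1 - b1) ^+ 2 + (a2 - b2) ^+ 2) = 1.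
  by rewrite dist_ab -exprMn mulVf // expr1n.
have ks : k * s = 1 - k * r by rewrite -(mulVf rs_neq0) -/k; ring.
split.
  (* The point of the first circle opposite to the point of contact is at
     distance |2 r + s| from b, which is |s| only if r (r + s) = 0. *)
  move=> eq_circles.
  have : circle (a1, a2) r (a1 - r * k * (b1 - a1), a2 - r * k * (b2 - a2)).
    rewrite /circle /=; transitivity
      (r ^+ 2 * (k ^+ 2 * ((a1 - b1) ^+ 2 + (a2 - b2) ^+ 2))); first by ring.
    by rewrite unit_ab mulr1.
  rewrite eq_circles /circle /= => dist_b.
  have : (2 * r + s) ^+ 2 = s ^+ 2.
    rewrite -dist_b; transitivity
      ((2 * r + s) ^+ 2 * (k ^+ 2 * ((a1 - b1) ^+ 2 + (a2 - b2) ^+ 2))).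
      by rewrite unit_ab mulr1.
    transitivity ((k * r + (k * r + k * s)) ^+ 2
                  * ((a1 - b1) ^+ 2 + (a2 - b2) ^+ 2)); first by ring.
    by rewrite ks; ring.
  move=> /eqP; rewrite -subr_eq0.
  have -> : (2 * r + s) ^+ 2 - s ^+ 2 = 4 * r * (r + s) by ring.
  by rewrite !mulf_eq0 (negPf r_neq0) (negPf rs_neq0) pnatr_eq0.
exists (a1, a2), (b1, b2), r, `|s|.
exists (a1 + k * r * (b1 - a1), a2 + k * r * (b2 - a2)).
split.
- by split.
- by split; [rewrite normr_gt0 | rewrite circle_norm].
- rewrite /circle /=; transitivity
    (r ^+ 2 * (k ^+ 2 * ((a1 - b1) ^+ 2 + (a2 - b2) ^+ 2))); first by ring.
  by rewrite unit_ab mulr1.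
- rewrite /circle /=; transitivity
    ((1 - k * r) ^+ 2 * ((a1 - b1) ^+ 2 + (a2 - b2) ^+ 2)); first by ring.
  rewrite -ks; transitivity
    (s ^+ 2 * (k ^+ 2 * ((a1 - b1) ^+ 2 + (a2 - b2) ^+ 2))); first by ring.
  by rewrite unit_ab mulr1.
- apply/seteqP; split=> -[q1 q2]; rewrite /tangent_line /=;
    set p1 := a1 + _; set p2 := a2 + _ => tangent_q.
  (* Both equations are multiples of the same linear form L in (q1, q2). *)
  all: pose L := (q1 - p1) * (b1 - a1) + (q2 - p2) * (b2 - a2).
  all: have tangent_a : (q1 - p1) * (p1 - a1) + (q2 - p2) * (p2 - a2)
         = k * r * L by rewrite /L /p1 /p2; ring.
  all: have tangent_b : (q1 - p1) * (p1 - b1) + (q2 - p2) * (p2 - b2)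
         = - (k * s) * L by rewrite ks /L /p1 /p2; ring.
  all: have L0 : L = 0.
  + move: tangent_q; rewrite tangent_a => /eqP.
    by rewrite !mulf_eq0 (negPf k_neq0) (negPf r_neq0) => /eqP.
  + by rewrite tangent_b L0 mulr0.
  + move: tangent_q; rewrite tangent_b => /eqP.
    by rewrite mulf_eq0 oppr_eq0 mulf_eq0 (negPf k_neq0) (negPf s_neq0) => /eqP.
  + by rewrite tangent_a L0 mulr0.
Qed.

(** Multiplying the equation by [d] completes both squares without division:
    it becomes [(d x - u)^2 + (d y - v)^2 = u^2 + v^2 - d w]. *)
Lemma quadric_circle (R : realType) (d u v w : R) (r : R) : d != 0 ->
  u ^+ 2 + v ^+ 2 - d * w = (d * r) ^+ 2 ->
  [set p : R * R | d * (p.1 ^+ 2 + p.2 ^+ 2) - 2 * u * p.1 - 2 * v * p.2 + w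
                   = 0]
  = circle (u / d, v / d) r.
Proof.
move=> d_neq0 disc; apply/seteqP.
have square_form x y :
    d * (d * (x ^+ 2 + y ^+ 2) - 2 * u * x - 2 * v * y + w)
    = d ^+ 2 * ((x - u / d) ^+ 2 + (y - v / d) ^+ 2 - r ^+ 2).
  transitivity ((d * x - u) ^+ 2 + (d * y - v) ^+ 2 - (d * r) ^+ 2).
    by rewrite -disc; ring.
  by field.
split=> -[x y]; rewrite /circle /= => on_curve.
- apply/eqP; rewrite -subr_eq0; move: (square_form x y).
  rewrite on_curve mulr0 => /esym/eqP.
  by rewrite mulf_eq0 expf_eq0 (negPf d_neq0).
- move: (square_form x y); rewrite on_curve subrr mulr0 => /eqP.
  by rewrite mulf_eq0 (negPf d_neq0) => /eqP.
Qed.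

Lemma descartes_radicand_collinear (R : realType) (r1 r2 : R) :
  r1 != 0 -> r2 != 0 -> r1 + r2 != 0 ->
  descartes_radicand r1 r2 (- (r1 + r2)) = 0.
Proof.
move=> r1_neq0 r2_neq0 r12_neq0; rewrite /descartes_radicand; field.
by rewrite r12_neq0 r1_neq0 r2_neq0.
Qed.

Theorem mainTheorem3 (R : realType) (r1 r2 : R) (r1_gt0 : 0 < r1)
    (r2_gt0 : 0 < r2) :
  let C1 : set (R * R) := [set p : R * R | (p.1 + r1) ^+ 2 + p.2 ^+ 2 = r1 ^+ 2] in
  let C2 : set (R * R) := [set p : R * R | (p.1 - r2) ^+ 2 + p.2 ^+ 2 = r2 ^+ 2] in
  let C3 : set (R * R) := circle (r2 - r1, 0) (r1 + r2) in
  let C4 : set (R * R) :=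
    [set p : R * R | (r1 ^+ 2 + r1 * r2 + r2 ^+ 2) * (p.1 ^+ 2 + p.2 ^+ 2)
             + 2 * r1 * r2 * (r2 - r1) * p.1
             - 4 * r1 * r2 * (r1 + r2) * p.2
             + 4 * r1 ^+ 2 * r2 ^+ 2 = 0] in
  let rho : R := r1 * r2 * (r1 + r2) / (r1 ^+ 2 + r1 * r2 + r2 ^+ 2) in
  [/\ touch C4 C1, touch C4 C2 & touch C4 C3] /\
  (forall (m : bool) (r4 : R),
     descartes_identity m r1 r2 (- (r1 + r2)) r4 <-> r4 = rho) /\
  has_radius C4 rho.
Proof.
move=> C1 C2 C3 C4 rho.
have r1_neq0 : r1 != 0 by rewrite gt_eqF.
have r2_neq0 : r2 != 0 by rewrite gt_eqF.
have r12_gt0 : 0 < r1 + r2 by rewrite addr_gt0.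
have r12_neq0 : r1 + r2 != 0 by rewrite gt_eqF.
pose d := r1 ^+ 2 + r1 * r2 + r2 ^+ 2.
have d_gt0 : 0 < d by rewrite !addr_gt0 ?exprn_gt0 ?mulr_gt0.
have d_neq0 : d != 0 by rewrite gt_eqF.
have rho_gt0 : 0 < rho by rewrite divr_gt0 ?mulr_gt0.
have rho_neq0 : rho != 0 by rewrite gt_eqF.
pose c4 := (r1 * r2 * (r1 - r2) / d, 2 * r1 * r2 * (r1 + r2) / d).
have C4E : C4 = circle c4 rho.
  rewrite -(@quadric_circle _ d _ _ (4 * r1 ^+ 2 * r2 ^+ 2)) //.
    rewrite /C4 /d; congr mkset; apply/funext => p; congr (_ = _); ring.
  have -> : d * rho = r1 * r2 * (r1 + r2) by rewrite /rho mulrC divfK.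
  by rewrite /d; ring.
have C1E : C1 = circle (- r1, 0) r1.
  by rewrite /C1 /circle /=; congr mkset; apply/funext => p;
    rewrite opprK subr0.
have C2E : C2 = circle (r2, 0) r2.
  by rewrite /C2 /circle /=; congr mkset; apply/funext => p; rewrite subr0.
have C3E : C3 = circle (r2 - r1, 0) (- (r1 + r2)).
  by rewrite /C3 -circle_norm -normrN circle_norm.
have inv_rho : 1 / r1 + 1 / r2 + 1 / (- (r1 + r2)) = 1 / rho.
  rewrite /rho; field.
  by rewrite d_neq0 r12_neq0 r2_neq0.
split; last split.
- split.
  + rewrite C4E C1E; apply: touch_signed_radii => //.
      by rewrite gt_eqF // addr_gt0.
    by rewrite /c4 /rho /d /=; field.
  + rewrite C4E C2E; apply: touch_signed_radii => //.
      by rewrite gt_eqF // addr_gt0.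
    by rewrite /c4 /rho /d /=; field.
  + rewrite C4E C3E; apply: touch_signed_radii => //.
    * by rewrite oppr_eq0.
    * have -> : rho + - (r1 + r2) = - ((r1 + r2) * (r1 ^+ 2 + r2 ^+ 2) / d).
        by rewrite /rho /d; field.
      by rewrite oppr_eq0 gt_eqF // divr_gt0 // mulr_gt0 // addr_gt0 ?exprn_gt0.
    * by rewrite /c4 /rho /d /=; field.
- move=> m r4; rewrite /descartes_identity descartes_radicand_collinear //.
  rewrite sqrtr0 !mulr0 addr0 inv_rho !div1r oppr_eq0 lexx; split.
    by move=> [_ _ /invr_inj].
  by move=> ->; split.
- by exists c4; split.
Qed.
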